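(* Let $\rho(c,\varepsilon)=\frac{1-\varepsilon^{c}}{c}$ if $c\le 1/2$ and $\rho(c,\varepsilon)=\frac{1-2(1-c)\sqrt{\varepsilon}-\varepsilon(2c-1)}{c}$ if $c\ge1/2$. For every rational constant $c\in(0,1)$ and constants $\varepsilon\in(0,1)$ and $\delta\in(0,\varepsilon]$, no algorithm using a number of value oracle queries that is sub-exponential in $|\mathcal N|$ can guarantee $(1-\varepsilon+\delta,\rho(c,\varepsilon))$-bicriteria approximation for the problem of maximizing a non-negative monotone submodular function $f\colon2^{\mathcal N}\to\mathbb R_{\ge0}$ subject to a cardinality constraint of density $c$.
   Context: $f$ is submodular if $f(S\cup\{u\})-f(S)\ge f(T\cup\{u\})-f(T)$ for all $S\subseteq T\subseteq\mathcal N$, $u\notin T$; monotone if $S\subseteq T$ implies $f(S)\le f(T)$. Algorithms access $f$ only via a value oracle returning $f(S)$. A cardinality constraint with integer budget $B$ declares a set feasible iff $|S|\le B$; its density is $c=B/|\mathcal N|$. Let $OPT$ be a feasible set maximizing $f$. A (possibly randomized) algorithm is an $(\alpha,\beta)$-bicriteria approximation algorithm if it outputs a set $S$ with $\mathbb E[f(S)]\ge\alpha f(OPT)$ and $|S|\le\beta B$. *)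

(* Defs.v *)
From HB Require Import structures.
From mathcomp Require Import all_boot all_order all_algebra.
From mathcomp Require Import all_classical all_reals all_analysis.
Set Implicit Arguments. Unset Strict Implicit. Unset Printing Implicit Defensive.
Import Order.TTheory GRing.Theory Num.Theory.
Local Open Scope ring_scope.

Definition monotone_setfun (R : realType) (n : nat) (f : {set 'I_n} -> R) :=
  forall S T : {set 'I_n}, S \subset T -> f S <= f T.

Definition submodular_setfun (R : realType) (n : nat) (f : {set 'I_n} -> R) :=
  forall (S T : {set 'I_n}) (u : 'I_n), S \subset T -> u \notin T ->
    f (u |: T) - f T <= f (u |: S) - f S.

Definition nonneg_setfun (R : realType) (n : nat) (f : {set 'I_n} -> R) :=
  forall S, 0 <= f S.

Definition valid_instance (R : realType) (n : nat) (f : {set 'I_n} -> R) :=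
  [/\ nonneg_setfun f, monotone_setfun f & submodular_setfun f].

Definition optval (R : realType) (n B : nat) (f : {set 'I_n} -> R) : R :=
  \big[Num.max/0]_(S : {set 'I_n} | (#|S| <= B)%N) f S.

(* Deterministic value-oracle query algorithms as (possibly infinitely
   branching, well-founded) decision trees: either output a set, or query
   the value of a set and continue depending on the answer. *)
Inductive qtree (R : Type) (n : nat) : Type :=
  | Output : {set 'I_n} -> qtree R n
  | Query : {set 'I_n} -> (R -> qtree R n) -> qtree R n.
Arguments Output {R n}.
Arguments Query {R n}.

Fixpoint run_out (R : Type) (n : nat) (t : qtree R n) (f : {set 'I_n} -> R)
  : {set 'I_n} :=
  match t with
  | Output X => X
  | Query X k => run_out (k (f X)) f
  end.

Fixpoint run_queries (R : Type) (n : nat) (t : qtree R n) (f : {set 'I_n} -> R)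
  : nat :=
  match t with
  | Output _ => 0%N
  | Query X k => (run_queries (k (f X)) f).+1
  end.

(* A randomized algorithm: for each ground set size n and budget B, a family
   of deterministic algorithms indexed by a random seed omega drawn from a
   probability space P on Omega. *)
Definition rand_alg (R : realType) (Omega : Type) :=
  forall n B : nat, Omega -> qtree R n.

Definition has_density (R : realType) (c : rat) (n B : nat) :=
  (B%:R : R) = ratr c * n%:R.

Definition alg_measurable (R : realType) (d : measure_display)
  (Omega : measurableType d) (A : rand_alg R Omega) :=
  forall n B (f : {set 'I_n} -> R) (S : {set 'I_n}),
    measurable [set w : Omega | run_out (A n B w) f = S]%classic.

Definition exp_value (R : realType) (d : measure_display)
  (Omega : measurableType d) (P : probability Omega R) (A : rand_alg R Omega)
  (n B : nat) (f : {set 'I_n} -> R) : R :=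
  \sum_(S : {set 'I_n}) fine (P [set w : Omega | run_out (A n B w) f = S]%classic) * f S.

Definition bicriteria (R : realType) (d : measure_display)
  (Omega : measurableType d) (P : probability Omega R) (A : rand_alg R Omega)
  (c : rat) (alpha beta : R) :=
  forall (n B : nat) (f : {set 'I_n} -> R),
    has_density R c n B -> valid_instance f ->
    alpha * optval B f <= exp_value P A B f /\
    (forall S : {set 'I_n}, beta * B%:R < #|S|%:R ->
       P [set w : Omega | run_out (A n B w) f = S]%classic = 0%E).

Definition query_bounded (R : realType) (Omega : Type) (A : rand_alg R Omega)
  (c : rat) (q : nat -> nat) :=
  forall (n B : nat) (f : {set 'I_n} -> R) (w : Omega),
    has_density R c n B -> valid_instance f ->
    (run_queries (A n B w) f <= q n)%N.

(* q(n) = 2^{o(n)}: for every k > 0, eventually q(n)^k <= 2^n. *)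
Definition subexponential (q : nat -> nat) :=
  forall k : nat, (0 < k)%N -> exists n0 : nat, forall n, (n0 <= n)%N ->
    (q n ^ k <= 2 ^ n)%N.

Definition rho (R : realType) (c : rat) (eps : R) : R :=
  let cr := ratr c : R in
  if cr <= 2^-1 then (1 - powR eps cr) / cr
  else (1 - 2 * (1 - cr) * Num.sqrt eps - eps * (2 * cr - 1)) / cr.

(* Main.v *)
Require Import Defs.
From HB Require Import structures.
From mathcomp Require Import all_boot all_order all_algebra.
From mathcomp Require Import all_classical all_reals all_analysis.
From mathcomp Require Import measurable_realfun ring lra.
Import Order.TTheory GRing.Theory Num.Theory.
Local Open Scope ring_scope.
Set Implicit Arguments.
Unset Strict Implicit.
Unset Printing Implicit Defensive.

(** The hidden optimum is encoded in the lost value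
    [L(x, y) = x * y ^ ((1 - k) / k)], where [x] and [y] are the fractions of a
    hidden part [H] (a fraction [k <= 1/2] of a set [M]) and of the decoy part
    [M \ H] that a set leaves out. On the diagonal [L] is [z ^ (1/k)] and its
    gradient is parallel to that of [z = k x + (1 - k) y], the fraction of [M]
    left out. Hence contracting [(x, y)] towards the diagonal by the
    soft-thresholding of [x - y] yields a function with nondecreasing
    nonnegative partial derivatives (so the value [1 - L] stays monotone and
    submodular) that depends on [z] alone as soon as [|x - y| <= theta].
    Cutting the ground set into blocks of constant size and hiding the optimum
    by an independent rotation of each block, a Chernoff bound makes every
    fixed set balanced except with exponentially small probability, so an
    algorithm with subexponentially many queries behaves as on the symmetric
    function [1 - z ^ (1/k)]. For [c <= 1/2] one takes [k = c] and [M] the whole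
    ground set. For [c > 1/2] one takes [k = 1/2], [M] a fraction [2 (1 - c)] of
    the ground set, and adds a linear function of the remaining elements whose
    slope matches the tangent of [z ^ 2] at [sqrt eps]. *)

(** * Comparing increments through slopes *)

(** Young's inequality for [y / x] and [1] with exponents [b] and [b / (b - 1)] is Bernoulli's
    inequality, which is then scaled by the [b]-th power of [x]. *)
Lemma powR_tangent (R : realType) (b x y : R) : 1 <= b -> 0 <= x -> 0 <= y ->
  x `^ b + b * x `^ (b - 1) * (y - x) <= y `^ b.
Proof.
move=> b1 x0 y0; have [b1'|bN1] := eqVneq b 1.
  by rewrite b1' subrr powRr0 !powRr1 //; lra.
have bgt : 1 < b by rewrite lt_neqAle eq_sym bN1.
have [->|xN0] := eqVneq x 0.
  rewrite !powR0; [|lra|lra]. by rewrite mulr0 mul0r addr0 powR_ge0.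
have xgt : 0 < x by rewrite lt_neqAle eq_sym xN0.
have xb : x `^ b = x * x `^ (b - 1).
  rewrite -{2}(powRr1 x0) -powRD; last by rewrite xN0 implybT.
  by congr (_ `^ _); ring.
have u0 : 0 <= y / x by rewrite divr_ge0.
have b0 : 0 < b by lra.
have c0 : 0 < b / (b - 1) by rewrite divr_gt0 //; lra.
have bc : b^-1 + (b / (b - 1))^-1 = 1 by field; lra.
have := conjugate_powR u0 ler01 b0 c0 bc.
rewrite powR1 mulr1 => H.
have H2 : b * (y / x) <= (y / x) `^ b + (b - 1).
  have := ler_wpM2l (ltW b0) H.
  suff -> : b * ((y / x) `^ b / b + 1 / (b / (b - 1))) =
            (y / x) `^ b + (b - 1) by [].
  by field; lra.
have yE : y `^ b = (y / x) `^ b * x `^ b by rewrite -powRM ?divfK.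
have pb : 0 <= x `^ b by apply: powR_ge0.
rewrite yE.
have := ler_wpM2r pb H2.
have -> : b * (y / x) * x `^ b = b * x `^ (b - 1) * y by rewrite xb; field.
have -> : b * x `^ (b - 1) * (y - x) = b * x `^ (b - 1) * y - b * x `^ b.
  by rewrite xb; ring.
by rewrite mulrDl mulrBl mul1r; lra.
Qed.

(* Riemann sums: with [N] equal steps the claim holds up to the telescoped error
   [(y - x) (p2 y - p2 x) / N], so no differentiability is needed. *)
Lemma increment_le_of_slope_le (R : realType) (g1 p1 g2 p2 : R -> R) (x y : R) :
  x <= y ->
  (forall u v, x <= u -> u <= v -> g1 v - g1 u <= (v - u) * p1 v) ->
  (forall u v, x <= u -> u <= v -> (v - u) * p2 u <= g2 v - g2 u) ->
  (forall u, x <= u -> p1 u <= p2 u) ->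
  g1 y - g1 x <= g2 y - g2 x.
Proof.
move=> xy H1 H2 p12.
have step N : (y - x) / N.+1%:R * (p2 x - p2 y) <=
    g2 y - g2 x - (g1 y - g1 x).
  set h := (y - x) / N.+1%:R.
  have h0 : 0 <= h by rewrite divr_ge0 ?subr_ge0.
  have key i : h * (p2 x - p2 (x + i%:R * h)) <=
      g2 (x + i%:R * h) - g2 x - (g1 (x + i%:R * h) - g1 x).
    elim: i => [|i IH]; first by rewrite mul0r addr0 !subrr mulr0.
    have ih0 : 0 <= i%:R * h by rewrite mulr_ge0.
    have E : x + i.+1%:R * h = x + i%:R * h + h by rewrite -natr1; ring.
    rewrite E; set u := x + i%:R * h in IH *.
    have xu : x <= u by rewrite /u; lra.
    have uv : u <= u + h by lra.
    have := H1 _ _ xu uv; have := H2 _ _ xu uv.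
    have -> : u + h - u = h by ring.
    have := ler_wpM2l h0 (p12 (u + h) (le_trans xu uv)).
    by move: IH; rewrite !mulrBr; lra.
  have := key N.+1; have -> : x + N.+1%:R * h = y.
    by rewrite /h; field.
  by [].
rewrite leNgt; apply/negP => lt.
set e := g1 y - g1 x - (g2 y - g2 x); have e0 : 0 < e by rewrite /e; lra.
set M := (y - x) * (p2 y - p2 x).
have [N NP] : exists N : nat, M / e < N%:R.
  by exists (Num.bound `|M / e|); apply: le_lt_trans (ler_norm _) (archi_boundP _).
have := step N.
have -> : (y - x) / N.+1%:R * (p2 x - p2 y) = - (M / N.+1%:R).
  by rewrite /M; field.
have : M / N.+1%:R < e.
  rewrite ltr_pdivrMr ?ltr0n // mulrC -ltr_pdivrMr //.
  by apply: lt_trans NP _; rewrite ltr_nat.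
rewrite /e; move: (M / _) => r; clear -r; lra.
Qed.

Definition slope_bounds (R : realType) (g p : R -> R) (u v : R) :=
  (v - u) * p u <= g v - g u <= (v - u) * p v.

(** An interval across [m] is cut there, and [p u <= p m <= p v] merges the bounds of the two
    pieces. *)
Lemma slope_bounds_glue (R : realType) (g p : R -> R) (l m : R) :
  (forall u v, l <= u -> u <= v -> p u <= p v) ->
  (forall u v, l <= u -> u <= v -> v <= m -> slope_bounds g p u v) ->
  (forall u v, l <= u -> u <= v -> m <= u -> slope_bounds g p u v) ->
  forall u v, l <= u -> u <= v -> slope_bounds g p u v.
Proof.
move=> pm Hl Hr u v lu uv.
have [vm|mv] := leP v m; first exact: Hl.
have [um|mu] := leP m u; first exact: Hr.
have := Hl u m lu (ltW mu) (lexx _).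
have := Hr m v (le_trans lu (ltW mu)) (ltW mv) (lexx _).
rewrite /slope_bounds => /andP[a1 a2] /andP[b1 b2].
have lm := le_trans lu (ltW mu).
have vm0 : 0 <= v - m by rewrite subr_ge0 ltW.
have mu0 : 0 <= m - u by rewrite subr_ge0 ltW.
have h1 := ler_wpM2l vm0 (pm _ _ lu (ltW mu)).
have h2 := ler_wpM2l mu0 (pm _ _ lm (ltW mv)).
by apply/andP; split; lra.
Qed.

(** * The lost value *)

Section HiddenLoss.
Context {R : realType}.
Variables (k b theta : R).

Definition clamp (t : R) : R := Num.max (- theta) (Num.min theta t).
(** With [shrink2], this moves [(x, y)] along a line of constant [k x + (1 - k) y]; the new
    difference is [(x - y) - clamp (x - y)]. *)
Definition shrink1 (x y : R) : R := x - (1 - k) * clamp (x - y).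
Definition shrink2 (x y : R) : R := y + k * clamp (x - y).
Definition loss (x y : R) : R := shrink1 x y * shrink2 x y `^ b.
(* [slope1] and [slope2] are the partial derivatives of [loss], also where
   [clamp] has a kink. *)
Definition slope1 (x y : R) : R := shrink2 x y `^ b.
Definition slope2 (x y : R) : R := b * shrink1 x y * shrink2 x y `^ (b - 1).

Hypotheses (k0 : 0 < k) (k1 : k < 1) (bk : b * k = 1 - k) (b1 : 1 <= b).
Hypothesis theta0 : 0 <= theta.

Lemma clamp_lip (s t : R) : s <= t -> 0 <= clamp t - clamp s <= t - s.
Proof.
move=> st; rewrite /clamp /Num.max /Num.min.
by do !case: ifPn => //=; rewrite -?leNgt => *; apply/andP; split; lra.
Qed.

Lemma clamp_id (t : R) : `|t| <= theta -> clamp t = t.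
Proof.
rewrite ler_norml => /andP[t1 t2].
by rewrite /clamp min_r // max_r.
Qed.

Lemma clamp_hi (t : R) : theta <= t -> clamp t = theta.
Proof. by move=> h; rewrite /clamp min_l // max_r // ge0_cp. Qed.

Lemma clamp_lo (t : R) : t <= - theta -> clamp t = - theta.
Proof.
move=> h; rewrite /clamp min_r ?max_l //.
by apply: le_trans h _; rewrite ge0_cp.
Qed.

(** If [x - y] grows, only [shrink1] is at risk, and [clamp], being 1-Lipschitz, grows by no more
    than [x] does; the other case is symmetric. *)
Lemma shrink_mono (x y x' y' : R) : x <= x' -> y <= y' ->
  shrink1 x y <= shrink1 x' y' /\ shrink2 x y <= shrink2 x' y'.
Proof.
move=> xx yy; rewrite /shrink1 /shrink2.
have ck (u v : R) : 0 <= u -> u <= v -> [/\ 0 <= k * u, k * u <= v,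
    0 <= (1 - k) * u & (1 - k) * u <= v].
  move=> u0 uv; have h1 := mulr_ge0 (ltW k0) u0.
  have k1' : 0 <= 1 - k by rewrite subr_ge0 ltW.
  by have := mulr_ge0 k1' u0; rewrite mulrBl mul1r => h2; split; lra.
have [h|/ltW h] := leP (x - y) (x' - y').
  have /andP[c0 c1] := clamp_lip h; have [] := ck _ _ c0 c1.
  by rewrite !mulrBr; split; lra.
have /andP[c0 c1] := clamp_lip h; have [] := ck _ _ c0 c1.
by rewrite !mulrBr; split; lra.
Qed.

Lemma shrink_ge0 (x y : R) : 0 <= x -> 0 <= y ->
  0 <= shrink1 x y /\ 0 <= shrink2 x y.
Proof.
move=> x0 y0; have := shrink_mono x0 y0.
have c0 : clamp (0 - 0) = 0 by rewrite subrr clamp_id // normr0.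
by rewrite {1}/shrink1 {1}/shrink2 c0 !mulr0 subr0 addr0.
Qed.

Lemma shrink2_powR_mono (e x y x' y' : R) : 0 <= e -> 0 <= x -> 0 <= y ->
  x <= x' -> y <= y' -> shrink2 x y `^ e <= shrink2 x' y' `^ e.
Proof.
move=> e0 x0 y0 xx yy; apply: ge0_ler_powR => //.
- by rewrite nnegrE; case: (shrink_ge0 x0 y0).
- by rewrite nnegrE; have [] // := @shrink_ge0 x' y'; lra.
- by case: (shrink_mono xx yy).
Qed.

Lemma slope1_mono (x y x' y' : R) : 0 <= x -> 0 <= y ->
  x <= x' -> y <= y' -> slope1 x y <= slope1 x' y'.
Proof. by move=> x0 y0 xx yy; apply: shrink2_powR_mono => //; apply: le_trans b1. Qed.

Lemma slope2_mono (x y x' y' : R) : 0 <= x -> 0 <= y ->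
  x <= x' -> y <= y' -> slope2 x y <= slope2 x' y'.
Proof.
move=> x0 y0 xx yy; have [s1 s2] := shrink_ge0 x0 y0.
have b0 : 0 <= b := le_trans ler01 b1.
apply: ler_pM; rewrite ?powR_ge0 ?mulr_ge0 //.
  by apply: ler_wpM2l => //; case: (shrink_mono xx yy).
by apply: shrink2_powR_mono; rewrite ?subr_ge0.
Qed.

(* The last hypothesis says that both points lie in a common closed region on
   which [clamp] is affine; there [loss] is either a translate of [x * y ^ b]
   or a function of [k x + (1 - k) y] alone. *)
Lemma loss_tangent (x y x' y' : R) :
  0 <= x -> 0 <= y -> 0 <= x' -> 0 <= y' ->
  (x <= x' /\ y <= y') \/ (x' <= x /\ y' <= y) ->
  (clamp (x' - y') - clamp (x - y)) * (x - y - clamp (x - y)) = 0 ->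
  slope1 x y * (x' - x) + slope2 x y * (y' - y) <= loss x' y' - loss x y.
Proof.
move=> x0 y0 x'0 y'0 cmp aff.
have [s1 s2] := shrink_ge0 x0 y0; have [s1' s2'] := shrink_ge0 x'0 y'0.
have b0 : 0 <= b := le_trans ler01 b1.
have tan := powR_tangent b1 s2 s2'.
have T1 : shrink1 x y * (b * shrink2 x y `^ (b - 1) * (shrink2 x' y' - shrink2 x y))
    <= shrink1 x y * (shrink2 x' y' `^ b - shrink2 x y `^ b).
  by apply: ler_wpM2l => //; lra.
(* Comparability of the points gives both increments the same sign, so their product is
   nonnegative. *)
have T2 : (shrink1 x' y' - shrink1 x y) * shrink2 x y `^ b
    <= (shrink1 x' y' - shrink1 x y) * shrink2 x' y' `^ b.
  case: cmp => -[xx yy]; have [m1 _] := shrink_mono xx yy.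
    apply: ler_wpM2l; first lra.
    by apply: shrink2_powR_mono.
  apply: ler_wnM2l; first lra.
  by apply: shrink2_powR_mono.
have xb : shrink2 x y `^ b = shrink2 x y * shrink2 x y `^ (b - 1).
  rewrite -{2}(powRr1 s2) -powRD; last by have b1' := b1; apply/implyP => /eqP; lra.
  by congr (_ `^ _); ring.
suff E : slope1 x y * (x' - x) + slope2 x y * (y' - y) =
    shrink1 x y * (b * shrink2 x y `^ (b - 1) * (shrink2 x' y' - shrink2 x y)) +
    (shrink1 x' y' - shrink1 x y) * shrink2 x y `^ b.
  rewrite E; apply: le_trans (lerD T1 T2) _.
  by rewrite /loss le_eqVlt; apply/orP; left; apply/eqP; ring.
rewrite /slope1 /slope2 xb.
move: (shrink2 x y `^ (b - 1)) => p.
apply/eqP; rewrite -subr_eq0; apply/eqP.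
rewrite /shrink1 /shrink2.
move: aff; move: (clamp (x' - y')) (clamp (x - y)) => c' c aff.
have bE : b = (1 - k) / k by rewrite -bk mulfK // gt_eqF.
(* With [b = (1 - k) / k] the two linear forms differ by a multiple of the product that [aff] makes
   zero. *)
transitivity (- (1 - k) * p * ((c' - c) * (x - y - c))); last by rewrite aff mulr0.
by rewrite bE; field; rewrite gt_eqF.
Qed.

Lemma clamp_affine (t t' : R) :
  [\/ t <= - theta /\ t' <= - theta, `|t| <= theta /\ `|t'| <= theta |
      theta <= t /\ theta <= t'] ->
  (clamp t' - clamp t) * (t - clamp t) = 0.
Proof.
case=> -[h h']; first by rewrite !clamp_lo // subrr mul0r.
  by rewrite (clamp_id h) subrr mulr0.
by rewrite !clamp_hi // subrr mul0r.
Qed.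

(** [loss_tangent] at each endpoint gives the two bounds on the three ranges cut by [y - theta] and
    [y + theta], which are then glued. *)
Lemma loss_slope_bounds1 (y u v : R) : 0 <= y -> 0 <= u -> u <= v ->
  slope_bounds (loss^~ y) (slope1^~ y) u v.
Proof.
move=> y0; have th0 := theta0.
have region u' v' : 0 <= u' -> u' <= v' ->
    [\/ v' <= y - theta, y - theta <= u' /\ v' <= y + theta | y + theta <= u'] ->
    slope_bounds (loss^~ y) (slope1^~ y) u' v'.
  move=> u0 uv reg; have v0 := le_trans u0 uv.
  have lo : slope1 u' y * (v' - u') + slope2 u' y * (y - y) <= loss v' y - loss u' y.
    apply: loss_tangent => //; first by left.
    by apply: clamp_affine; case: reg => [?|[? ?]|?];
      [apply: Or31|apply: Or32|apply: Or33]; rewrite ?ler_norml; split; lra.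
  have hi : slope1 v' y * (u' - v') + slope2 v' y * (y - y) <= loss u' y - loss v' y.
    apply: loss_tangent => //; first by right.
    by apply: clamp_affine; case: reg => [?|[? ?]|?];
      [apply: Or31|apply: Or32|apply: Or33]; rewrite ?ler_norml; split; lra.
  by move: lo hi; rewrite subrr !mulr0 !addr0 => lo hi; apply/andP; split; lra.
have mono u' v' : 0 <= u' -> u' <= v' -> slope1 u' y <= slope1 v' y.
  by move=> *; apply: slope1_mono.
move: u v; apply: (slope_bounds_glue (m := y - theta)) => //.
  by move=> u v u0 uv vm; apply: region => //; apply: Or31.
move=> u v u0 uv mu.
(* The second gluing starts at [max 0 (y - theta)]: [y - theta] may be negative, where [mono] does
   not apply. *)
have mono' u' v' : Num.max 0 (y - theta) <= u' -> u' <= v' ->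
    slope1 u' y <= slope1 v' y.
  by rewrite ge_max => /andP[? _] ?; apply: mono.
apply: (slope_bounds_glue (l := Num.max 0 (y - theta)) (m := y + theta)) => //.
- move=> u' v'; rewrite ge_max => /andP[? ?] ? ?; apply: region => //; exact: Or32.
- move=> u' v'; rewrite ge_max => /andP[? ?] ? ?; apply: region => //; exact: Or33.
- by rewrite ge_max u0.
Qed.

Lemma loss_slope_bounds2 (x u v : R) : 0 <= x -> 0 <= u -> u <= v ->
  slope_bounds (loss x) (slope2 x) u v.
Proof.
move=> x0; have th0 := theta0.
have region u' v' : 0 <= u' -> u' <= v' ->
    [\/ v' <= x - theta, x - theta <= u' /\ v' <= x + theta | x + theta <= u'] ->
    slope_bounds (loss x) (slope2 x) u' v'.
  move=> u0 uv reg; have v0 := le_trans u0 uv.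
  have lo : slope1 x u' * (x - x) + slope2 x u' * (v' - u') <= loss x v' - loss x u'.
    apply: loss_tangent => //; first by left.
    by apply: clamp_affine; case: reg => [?|[? ?]|?];
      [apply: Or33|apply: Or32|apply: Or31]; rewrite ?ler_norml; split; lra.
  have hi : slope1 x v' * (x - x) + slope2 x v' * (u' - v') <= loss x u' - loss x v'.
    apply: loss_tangent => //; first by right.
    by apply: clamp_affine; case: reg => [?|[? ?]|?];
      [apply: Or33|apply: Or32|apply: Or31]; rewrite ?ler_norml; split; lra.
  by move: lo hi; rewrite subrr !mulr0 !add0r => lo hi; apply/andP; split; lra.
have mono u' v' : 0 <= u' -> u' <= v' -> slope2 x u' <= slope2 x v'.
  by move=> *; apply: slope2_mono.
move: u v; apply: (slope_bounds_glue (m := x - theta)) => //.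
  by move=> u v u0 uv vm; apply: region => //; apply: Or31.
move=> u v u0 uv mu.
have mono' u' v' : Num.max 0 (x - theta) <= u' -> u' <= v' ->
    slope2 x u' <= slope2 x v'.
  by rewrite ge_max => /andP[? _] ?; apply: mono.
apply: (slope_bounds_glue (l := Num.max 0 (x - theta)) (m := x + theta)) => //.
- move=> u' v'; rewrite ge_max => /andP[? ?] ? ?; apply: region => //; exact: Or32.
- move=> u' v'; rewrite ge_max => /andP[? ?] ? ?; apply: region => //; exact: Or33.
- by rewrite ge_max u0.
Qed.

(** The continuous form of diminishing returns: the step is a move in [y] followed by one in [x],
    and on each leg the slope at the larger point dominates. *)
Lemma loss_increment_mono (x y x' y' w1 w2 : R) :
  0 <= x -> x <= x' -> 0 <= y -> y <= y' -> 0 <= w1 -> 0 <= w2 ->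
  loss (x + w1) (y + w2) - loss x y <= loss (x' + w1) (y' + w2) - loss x' y'.
Proof.
move=> x0 xx y0 yy w10 w20.
have step1 a a' : 0 <= a -> a <= a' ->
    loss (x + w1) a - loss x a <= loss (x' + w1) a' - loss x' a'.
  move=> a0 aa.
  have := @increment_le_of_slope_le R (fun s => loss (x + s) a)
    (fun s => slope1 (x + s) a) (fun s => loss (x' + s) a')
    (fun s => slope1 (x' + s) a') 0 w1 w10.
  rewrite !addr0; apply.
  - move=> u v u0 uv; have /andP[_] := @loss_slope_bounds1 a (x + u) (x + v) a0
      ltac:(lra) ltac:(lra).
    by have -> : x + v - (x + u) = v - u by ring.
  - move=> u v u0 uv; have /andP[+ _] := @loss_slope_bounds1 a' (x' + u) (x' + v)
      ltac:(lra) ltac:(lra) ltac:(lra).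
    by have -> : x' + v - (x' + u) = v - u by ring.
  - by move=> u u0; apply: slope1_mono => //; lra.
have step2 : loss x (y + w2) - loss x y <= loss x' (y' + w2) - loss x' y'.
  have := @increment_le_of_slope_le R (fun s => loss x (y + s))
    (fun s => slope2 x (y + s)) (fun s => loss x' (y' + s))
    (fun s => slope2 x' (y' + s)) 0 w2 w20.
  rewrite !addr0; apply.
  - move=> u v u0 uv; have /andP[_] := @loss_slope_bounds2 x (y + u) (y + v) x0
      ltac:(lra) ltac:(lra).
    by have -> : y + v - (y + u) = v - u by ring.
  - move=> u v u0 uv; have /andP[+ _] := @loss_slope_bounds2 x' (y' + u) (y' + v)
      ltac:(lra) ltac:(lra) ltac:(lra).
    by have -> : y' + v - (y' + u) = v - u by ring.
  - by move=> u u0; apply: slope2_mono => //; lra.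
have := step1 (y + w2) (y' + w2) ltac:(lra) ltac:(lra).
by move: step2; lra.
Qed.

Lemma loss_mono (x y x' y' : R) : 0 <= x -> x <= x' -> 0 <= y -> y <= y' ->
  loss x y <= loss x' y'.
Proof.
move=> x0 xx y0 yy; have [s1 s2] := shrink_ge0 x0 y0.
apply: ler_pM; rewrite ?powR_ge0 //; first by case: (shrink_mono xx yy).
by apply: shrink2_powR_mono => //; apply: le_trans b1.
Qed.

Lemma loss_ge0 (x y : R) : 0 <= x -> 0 <= y -> 0 <= loss x y.
Proof.
by move=> x0 y0; have [s1 s2] := shrink_ge0 x0 y0; rewrite mulr_ge0 ?powR_ge0.
Qed.

Lemma loss_near_diagonal (x y : R) : `|x - y| <= theta ->
  loss x y = (k * x + (1 - k) * y) * (k * x + (1 - k) * y) `^ b.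
Proof.
move=> h; rewrite /loss /shrink1 /shrink2 clamp_id //.
have -> : x - (1 - k) * (x - y) = k * x + (1 - k) * y by ring.
by have -> : y + k * (x - y) = k * x + (1 - k) * y by ring.
Qed.

Lemma loss11 : loss 1 1 = 1.
Proof.
rewrite loss_near_diagonal; last by rewrite subrr normr0.
have -> : k * 1 + (1 - k) * 1 = 1 by ring.
by rewrite powR1 mulr1.
Qed.

(** The point [(0, 1)] is the hidden optimum, which takes the hidden part and leaves out all decoys;
    the contraction costs it only [shrink1 = (1 - k) * theta]. *)
Lemma loss01 : theta <= 1 -> loss 0 1 <= theta.
Proof.
move=> th1; rewrite /loss /shrink1 /shrink2 clamp_lo; last by rewrite sub0r lerN2.
have [th0 k0' k1'] := And3 theta0 k0 k1.
have kt0 : 0 <= k * theta by rewrite mulr_ge0 // ltW.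
have kt1 : k * theta <= theta by rewrite ler_piMl // ltW.
have p1 : (1 + k * - theta) `^ b <= 1.
  have b0 : 0 <= b by apply: le_trans b1.
  apply: (@le_trans _ _ (1 `^ b)); last by rewrite powR1.
  by apply: ge0_ler_powR; rewrite ?nnegrE //; lra.
rewrite -[leRHS]mulr1; apply: ler_pM; rewrite ?powR_ge0 //; lra.
Qed.
End HiddenLoss.

(** * Set functions built from the lost value *)

Definition outer_weight {R : realType} {n : nat} (W : 'I_n -> R)
  (S : {set 'I_n}) : R := \sum_(i | i \notin S) W i.

Lemma outer_weight_ge0 (R : realType) (n : nat) (W : 'I_n -> R) (S : {set 'I_n}) :
  (forall i, 0 <= W i) -> 0 <= outer_weight W S.
Proof. by move=> W0; apply: sumr_ge0. Qed.

Lemma outer_weight_setU1 (R : realType) (n : nat) (W : 'I_n -> R) (S : {set 'I_n}) u :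
  u \notin S -> outer_weight W S = outer_weight W (u |: S) + W u.
Proof.
move=> uS; rewrite /outer_weight (bigD1 u) //= addrC; congr (_ + _).
by apply: eq_bigl => i; rewrite !inE negb_or andbC.
Qed.

Lemma outer_weight_anti (R : realType) (n : nat) (W : 'I_n -> R) (S T : {set 'I_n}) :
  (forall i, 0 <= W i) -> S \subset T -> outer_weight W T <= outer_weight W S.
Proof.
move=> W0 ST; rewrite /outer_weight [leRHS]big_mkcond [leLHS]big_mkcond /=.
apply: ler_sum => i _; case: ifPn => [iT|_]; last by case: ifP.
by rewrite ifT //; apply: contra iT; apply: (fintype.subsetP ST).
Qed.

Definition hidden_fun {R : realType} {n : nat} (k b theta mu : R)
  (W1 W2 W3 : 'I_n -> R) (S : {set 'I_n}) : R :=
  1 - mu * loss k b theta (outer_weight W1 S) (outer_weight W2 S)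
    - outer_weight W3 S.

(** Adding [u] lowers the left-out weights by [W1 u], [W2 u], [W3 u], so submodularity is
    [loss_increment_mono] at the points of [u |: T] and [u |: S]. Nonnegativity follows from
    monotonicity, as the empty set loses at most [mu + (1 - mu)]. *)
Lemma hidden_fun_valid (R : realType) (n : nat) (k b theta mu : R)
    (W1 W2 W3 : 'I_n -> R) :
  0 < k -> k < 1 -> b * k = 1 - k -> 1 <= b -> 0 <= theta -> 0 <= mu ->
  (forall i, 0 <= W1 i) -> (forall i, 0 <= W2 i) -> (forall i, 0 <= W3 i) ->
  \sum_i W1 i = 1 -> \sum_i W2 i = 1 -> \sum_i W3 i <= 1 - mu ->
  valid_instance (hidden_fun k b theta mu W1 W2 W3).
Proof.
move=> k0 k1 bk b1 th0 mu0 W10 W20 W30 W1s W2s W3s.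
have mono : monotone_setfun (hidden_fun k b theta mu W1 W2 W3).
  move=> S T ST; rewrite /hidden_fun.
  have := outer_weight_anti W30 ST.
  have : mu * loss k b theta (outer_weight W1 T) (outer_weight W2 T)
     <= mu * loss k b theta (outer_weight W1 S) (outer_weight W2 S).
    by apply: ler_wpM2l => //; apply: loss_mono => //;
      rewrite ?outer_weight_ge0 ?outer_weight_anti.
  by lra.
have tot (W : 'I_n -> R) : outer_weight W finset.set0 = \sum_i W i.
  by apply: eq_bigl => i; rewrite inE.
split => //.
  move=> S; apply: le_trans (mono _ _ (finset.sub0set S)).
  by rewrite /hidden_fun !tot W1s W2s loss11 //; lra.
move=> S T u ST uT.
have uS : u \notin S by apply: contra uT; apply: (fintype.subsetP ST).
have sub : u |: S \subset u |: T by apply: finset.setUS.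
rewrite /hidden_fun.
rewrite [in X in _ <= _ - X](outer_weight_setU1 W3 uS).
rewrite [in X in _ <= _ - X](outer_weight_setU1 W1 uS).
rewrite [in X in _ <= _ - X](outer_weight_setU1 W2 uS).
rewrite [in X in _ - X <= _](outer_weight_setU1 W3 uT).
rewrite [in X in _ - X <= _](outer_weight_setU1 W1 uT).
rewrite [in X in _ - X <= _](outer_weight_setU1 W2 uT).
have := @loss_increment_mono R k b theta k0 k1 bk b1 th0 _ _ _ _ (W1 u) (W2 u)
  (outer_weight_ge0 _ W10) (outer_weight_anti W10 sub)
  (outer_weight_ge0 _ W20) (outer_weight_anti W20 sub) (W10 u) (W20 u).
move/(ler_wpM2l mu0); rewrite !mulrBr; lra.
Qed.

Lemma hidden_fun_le1 (R : realType) (n : nat) (k b theta mu : R)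
    (W1 W2 W3 : 'I_n -> R) S :
  0 < k -> k < 1 -> b * k = 1 - k -> 1 <= b -> 0 <= theta -> 0 <= mu ->
  (forall i, 0 <= W1 i) -> (forall i, 0 <= W2 i) -> (forall i, 0 <= W3 i) ->
  hidden_fun k b theta mu W1 W2 W3 S <= 1.
Proof.
move=> k0 k1 bk b1 th0 mu0 W10 W20 W30; rewrite /hidden_fun.
have := outer_weight_ge0 S W30.
have : 0 <= mu * loss k b theta (outer_weight W1 S) (outer_weight W2 S).
  by rewrite mulr_ge0 // loss_ge0 // outer_weight_ge0.
lra.
Qed.

(** * A Chernoff bound on product spaces *)

(** Since [expR (- x) >= 1 - x], the left side is at most [1 / (1 - x)]. *)
Lemma expR_le_quad (R : realType) (x : R) :
  x <= 2^-1 -> expR x <= 1 + x + 2 * x ^+ 2.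
Proof.
move=> x2; have h : 0 < 1 - x by lra.
have e : expR x <= (1 - x)^-1.
  rewrite -[expR x]invrK lef_pV2 ?posrE ?invr_gt0 ?expR_gt0 //.
  by rewrite -expRN; have := expR_ge1Dx (- x); lra.
apply: le_trans e _; rewrite -div1r ler_pdivrMr //.
have -> : (1 + x + 2 * x ^+ 2) * (1 - x) = 1 + x ^+ 2 * (1 - 2 * x) by ring.
by rewrite lerDl mulr_ge0 ?sqr_ge0 //; lra.
Qed.

Lemma markov_count (R : realType) (T : finType) (X : T -> R) (t : R) :
  0 < t -> (forall a, 0 <= X a) ->
  #|[set a | t <= X a]|%:R * t <= \sum_a X a.
Proof.
move=> t0 X0; rewrite (bigID (mem [set a | t <= X a])) /=.
apply: (@le_trans _ _ (\sum_(a in [set a | t <= X a]) X a)); last first.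
  by rewrite lerDl sumr_ge0.
rewrite mulr_natl -sumr_const; apply: ler_sum => a; by rewrite inE.
Qed.

(** Markov's inequality for the exponential moment of a uniform [f]. The lower threshold
    [1 + s * theta] per coordinate keeps exponentials out of the rate. *)
Lemma chernoff_upper (R : realType) (K theta s : R) (I J : finType)
    (Z : I -> J -> R) :
  0 <= s -> 0 <= K -> 0 <= theta -> s * K <= 2^-1 ->
  (forall i j, `|Z i j| <= K) -> (forall i, \sum_j Z i j = 0) ->
  #|[set f : {ffun I -> J} | theta * #|I|%:R <= \sum_i Z i (f i)]|%:R <=
    ((1 + 2 * (s * K) ^+ 2) / (1 + s * theta)) ^+ #|I| * (#|J| ^ #|I|)%:R.
Proof.
move=> s0 K0 th0 sK ZK Zs.
set E := [set f : {ffun I -> J} | _].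
have den : 0 < 1 + s * theta by rewrite ltr_pwDl ?mulr_ge0.
have sub : E \subset [set f : {ffun I -> J} |
    (1 + s * theta) ^+ #|I| <= \prod_i expR (s * Z i (f i))].
  apply/fintype.subsetP => f; rewrite !inE => hf.
  rewrite -expR_sum -mulr_sumr.
  apply: (@le_trans _ _ (expR (s * theta) ^+ #|I|)).
    rewrite lerXn2r ?nnegrE ?(ltW den) ?expR_ge0 //; exact: expR_ge1Dx.
  by rewrite -expRM_natr ler_expR -mulrA; apply: ler_wpM2l.
have m := @markov_count R {ffun I -> J} (fun f => \prod_i expR (s * Z i (f i)))
  ((1 + s * theta) ^+ #|I|) (exprn_gt0 _ den)
  (fun f => ltac:(by apply: prodr_ge0 => i _; apply: expR_ge0)).
rewrite expr_div_n mulrAC ler_pdivlMr ?exprn_gt0 //.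
apply: (@le_trans _ _ (#|[set f : {ffun I -> J} |
    ((1 + s * theta) ^+ #|I| <= \prod_i expR (s * Z i (f i)))%R]|%:R *
      (1 + s * theta) ^+ #|I|)).
  by rewrite ler_wpM2r ?exprn_ge0 ?(ltW den) // ler_nat subset_leq_card.
apply: le_trans m _.
(* Independence: the sum over all functions is a product of sums, one per coordinate. *)
rewrite -(bigA_distr_bigA (fun i j => expR (s * Z i j))) /=.
rewrite natrX -exprMn -prodr_const.
apply: ler_prod => i _; apply/andP; split; first by apply: sumr_ge0 => j _; apply: expR_ge0.
apply: (@le_trans _ _ (\sum_j (1 + s * Z i j + 2 * (s * K) ^+ 2))).
  apply: ler_sum => j _.
  have sz : `|s * Z i j| <= s * K by rewrite normrM ger0_norm // ler_wpM2l.
  have q := @expR_le_quad R (s * Z i j) ltac:(apply: le_trans sK; apply: le_trans (ler_norm _) sz).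
  apply: le_trans q _; rewrite lerD2l ler_wpM2l //.
  by rewrite -real_normK ?num_real // lerXn2r ?nnegrE ?mulr_ge0.
rewrite !big_split /= -mulr_sumr Zs mulr0 addr0 !sumr_const -mulrnDl.
by rewrite -[X in X <= _]mulr_natr.
Qed.

(** The rate depends on [K] and [theta] alone. The factor 2 comes from treating [Z] and [- Z]. *)
Lemma chernoff_rate (R : realType) (K theta : R) : 0 < K -> 0 < theta ->
  exists lam : R, [/\ 0 <= lam, lam < 1 & forall (I J : finType) (Z : I -> J -> R),
    (forall i j, `|Z i j| <= K) -> (forall i, \sum_j Z i j = 0) ->
    #|[set f : {ffun I -> J} | theta * #|I|%:R <= `|\sum_i Z i (f i)|]|%:R <=
      2 * lam ^+ #|I| * (#|J| ^ #|I|)%:R].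
Proof.
move=> K0 th0.
(* The first bound gives [s * K <= 1/2]; the second keeps the quadratic term [2 (s K)^2] below half
   of [s * theta]. *)
set s := Num.min ((2 * K)^-1) (theta / (4 * K ^+ 2)).
have s0 : 0 < s by rewrite lt_min !(invr_gt0, divr_gt0, mulr_gt0, exprn_gt0).
have s1 : s * K <= 2^-1.
  apply: (@le_trans _ _ ((2 * K)^-1 * K)); last by rewrite invfM mulfVK // gt_eqF.
  by rewrite ler_wpM2r ?(ltW K0) // ge_min lexx.
have s2 : 2 * s * K ^+ 2 <= theta / 2.
  apply: (@le_trans _ _ (2 * (theta / (4 * K ^+ 2)) * K ^+ 2)); last first.
    by rewrite le_eqVlt; apply/orP; left; apply/eqP; field; rewrite gt_eqF.
  by rewrite ler_wpM2r ?exprn_ge0 ?(ltW K0) // ler_wpM2l // ge_min lexx orbT.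
have den : 0 < 1 + s * theta by rewrite ltr_pwDl ?mulr_ge0 ?ltW.
exists ((1 + 2 * (s * K) ^+ 2) / (1 + s * theta)); split.
- by rewrite divr_ge0 ?(ltW den) // addr_ge0 // mulr_ge0 // sqr_ge0.
- rewrite ltr_pdivrMr // mul1r ltrD2l.
  have -> : 2 * (s * K) ^+ 2 = s * (2 * s * K ^+ 2) by ring.
  by rewrite ltr_pM2l //; apply: le_lt_trans s2 _; lra.
move=> I J Z ZK Zs.
have up := chernoff_upper (ltW s0) (ltW K0) (ltW th0) s1 ZK Zs.
have lo := @chernoff_upper R K theta s I J (fun i j => - Z i j) (ltW s0) (ltW K0)
  (ltW th0) s1 (fun i j => ltac:(by rewrite normrN))
  (fun i => ltac:(by rewrite sumrN Zs oppr0)).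
set A := [set f | _] in up; set B := [set f | _] in lo.
set C := [set f | _].
have sub : C \subset A :|: B.
  apply/fintype.subsetP => f; rewrite !inE sumrN => h.
  have [h0|h0] := leP 0 (\sum_i Z i (f i)).
    by rewrite -(ger0_norm h0) h.
  by rewrite orbC -(ltr0_norm h0) h.
have : (#|C| <= #|A| + #|B|)%N.
  by apply: leq_trans (subset_leq_card sub) _; rewrite cardsU leq_subr.
rewrite -(ler_nat R) natrD => cABC.
by apply: le_trans cABC _; rewrite -mulrA mulr_natl mulr2n; apply: lerD.
Qed.

(** * Query trees and averaging over instances *)

(** The output is listed too, so that agreement on the list also settles the value obtained. *)
Fixpoint probed {R : Type} {n : nat} (t : qtree R n) (f : {set 'I_n} -> R) :
  seq {set 'I_n} :=
  match t with
  | Output X => [:: X]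
  | Query X h => X :: probed (h (f X)) f
  end.

Lemma size_probed (R : Type) (n : nat) (t : qtree R n) f :
  size (probed t f) = (run_queries t f).+1.
Proof. by elim: t => //= X h IH; rewrite IH. Qed.

Lemma run_out_probed (R : Type) (n : nat) (t : qtree R n) f :
  run_out t f \in probed t f.
Proof. by elim: t => [X|X h IH] /=; rewrite inE ?eqxx // IH orbT. Qed.

Lemma run_out_agree (R : Type) (n : nat) (t : qtree R n) (f g : {set 'I_n} -> R) :
  (forall X, X \in probed t g -> f X = g X) -> run_out t f = run_out t g.
Proof.
elim: t => //= X h IH agree.
rewrite agree ?inE ?eqxx //; apply: IH => Y hY.
by apply: agree; rewrite inE hY orbT.
Qed.

(* Unless one of the sets probed on [g] tells [f s] from [g], the algorithm
   cannot distinguish the two and returns its output on [g]. *)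
Lemma sum_run_out_le (R : realType) (n : nat) (I : finType) (t : qtree R n)
    (f : I -> {set 'I_n} -> R) (g : {set 'I_n} -> R) (eta : R) (m : nat) :
  (forall i S, f i S <= 1) -> 0 <= g (run_out t g) -> 0 <= eta ->
  (forall S, #|[set i | f i S != g S]|%:R <= eta) ->
  (run_queries t g <= m)%N ->
  \sum_i f i (run_out t (f i)) <= #|I|%:R * g (run_out t g) + m.+1%:R * eta.
Proof.
move=> f1 g0 eta0 diff qm.
set bad := [set i | has (fun X => f i X != g X) (probed t g)].
(* A union bound over the probed sets. *)
have badP : #|bad|%:R <= m.+1%:R * eta.
  apply: (@le_trans _ _ ((size (probed t g))%:R * eta)); last first.
    by rewrite size_probed ler_wpM2r // ler_nat.
  rewrite /bad; elim: (probed t g) => [|X s IH].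
    by rewrite (_ : [set i | _] = finset.set0) ?cards0 ?mul0r //; apply/setP => i; rewrite !inE.
  rewrite /= -natr1 mulrDl mul1r addrC.
  apply: le_trans (lerD (diff X) IH); rewrite -natrD ler_nat.
  rewrite (_ : [set i | _] = [set i | f i X != g X] :|:
    [set i | has (fun X => f i X != g X) s]); last by apply/setP => i; rewrite !inE.
  by rewrite cardsU leq_subr.
apply: le_trans (lerD (lexx _) badP).
rewrite (bigID (mem bad)) /= addrC; apply: lerD; last first.
  by rewrite -sum1_card natr_sum; apply: ler_sum.
apply: (@le_trans _ _ (\sum_(i | i \notin bad) g (run_out t g))).
  apply: ler_sum => i ib.
  have agree X : X \in probed t g -> f i X = g X.
    move=> hX; apply/eqP; apply: contraNT ib => ne.
    by rewrite inE; apply/hasP; exists X.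
  by rewrite (run_out_agree agree) agree // run_out_probed.
by rewrite sumr_const -[leLHS]mulr_natl ler_wpM2r // ler_nat max_card.
Qed.

(** Here [w] is the random seed, [X i] the output on instance [i], [Y] the output on the symmetric
    function, and [B] marks oversized outputs: a bound valid for almost every seed is integrated. *)
Lemma sum_expectation_le (R : realType) (d : measure_display)
    (Omega : measurableType d) (P : probability Omega R) (I T : finType)
    (X : I -> Omega -> T) (F : I -> T -> R) (Y : Omega -> T) (B : pred T) (K : R) :
  (forall i x, measurable [set w | X i w = x]%classic) ->
  (forall x, measurable [set w | Y w = x]%classic) ->
  (forall x, B x -> P [set w | Y w = x]%classic = 0%E) ->
  (forall i x, 0 <= F i x) -> 0 <= K ->
  (forall w, ~~ B (Y w) -> \sum_i F i (X i w) <= K) ->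
  \sum_i \sum_x fine (P [set w | X i w = x]%classic) * F i x <= K.
Proof.
move=> mX mY PB F0 K0 bound.
have Pfin A : measurable A -> P A \is a fin_num by move=> mA; apply: fin_num_measure.
rewrite -lee_fin.
pose f (k : I * T) (w : Omega) : \bar R :=
  ((F k.1 k.2)%:E * (\1_[set w | X k.1 w = k.2]%classic w)%:E)%E.
have mf k : measurable_fun setT (f k).
  by apply/measurable_EFinP; apply: measurable_funM.
have f0 k w : (0 <= f k w)%E by rewrite mule_ge0 // lee_fin.
have -> : (\sum_i \sum_x fine (P [set w | X i w = x]%classic) * F i x)%:E =
    (\int[P]_w \sum_(k <- index_enum (I * T)%type) f k w)%E.
  rewrite ge0_integral_sum //.
  rewrite pair_bigA /= -sumEFin; apply: eq_bigr => -[i x] _ /=.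
  have mI : measurable_fun setT
      (fun w => (\1_[set w | X i w = x]%classic w : R)%:E).
    by apply/measurable_EFinP; apply: measurable_indic.
  rewrite /f /= (ge0_integralZl_EFin P measurableT _ mI) ?lee_fin //.
  by rewrite integral_indic // setIT EFinM fineK ?Pfin // muleC.
have -> : K%:E = (\int[P]_w (cst K%:E w))%E.
  have P1 : P setT = 1%E by exact: probability_setT.
  by rewrite integral_cst // [X in (_ * X)%E](_ : _ = 1%E) ?mule1 //; exact: P1.
apply: ae_ge0_le_integral => //.
- by move=> w _; apply: sume_ge0.
- by apply: emeasurable_sum.
exists (\bigcup_(x in [set` B]) [set w | Y w = x])%classic; split.
- by apply: fin_bigcup_measurable.
- rewrite measure_fin_bigcup //; first by apply: fsbig1 => x /PB.
  by apply/trivIsetP => x y _ _ xy; apply/seteqP; split => w //= -[-> /eqP]; rewrite (negbTE xy).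
- move=> w /= h; apply: contrapT => nw; apply: h => _.
  have nB : ~~ B (Y w) by apply/negP => b; apply: nw; exists (Y w).
  have -> : (\sum_k f k w = (\sum_i F i (X i w))%:E)%E.
    rewrite /f -(pair_bigA _ (fun i x =>
      ((F i x)%:E * (\1_[set w | X i w = x]%classic w)%:E)%E)) /=.
    rewrite -sumEFin; apply: eq_bigr => i _.
    rewrite (bigD1 (X i w)) //= big1 ?adde0.
      by rewrite indicE mem_set // mule1.
    move=> x xne; rewrite indicE memNset ?mule0 //= => e.
    by rewrite e eqxx in xne.
  by rewrite lee_fin bound.
Qed.

(** * Hiding the optimum in rotated blocks *)

(** The inverse of [mxvec_index]: block number and position in the block. *)
Definition cell {N q : nat} (i : 'I_(N * q)) : 'I_N * 'I_q :=
  enum_val (cast_ord (esym (mxvec_cast N q)) i).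

Lemma cell_mxvec_index (N q : nat) (j : 'I_N) (r : 'I_q) :
  cell (mxvec_index j r) = (j, r).
Proof. by rewrite /cell /mxvec_index cast_ordK enum_rankK. Qed.

Lemma sum_cells (R : realType) (N q : nat) (F : 'I_(N * q) -> R) :
  \sum_i F i = \sum_j \sum_r F (mxvec_index j r).
Proof.
rewrite pair_bigA /= (reindex (fun x : 'I_N * 'I_q => mxvec_index x.1 x.2)) //.
apply: onW_bij; exists cell => [[j r]|i]; first exact: cell_mxvec_index.
by case/mxvec_indexP: i => j r; rewrite cell_mxvec_index.
Qed.

Lemma sum_low (R : realType) (q w : nat) (F : 'I_w.+1 -> R) : (w < q)%N ->
  \sum_(r < q) (if (r < w.+1)%N then F (inord r) else 0) = \sum_x F x.
Proof.
move=> wq; rewrite -big_mkcond -(big_ord_widen q (fun i => F (inord i))) //=.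
by apply: eq_bigr => x _; rewrite inord_val.
Qed.

Lemma sum_shift (R : realType) (w : nat) (G : 'I_w.+1 -> R) s :
  \sum_x G (x + s) = \sum_x G x.
Proof. by rewrite [RHS](reindex_inj (addIr s)). Qed.

Lemma sum_threshold (R : realType) (w a : nat) (c d : R) : (a <= w)%N ->
  \sum_(x < w) (if (x < a)%N then c else d) = c * a%:R + d * (w - a)%:R.
Proof.
move=> aw; rewrite -(big_mkord xpredT (fun x => if (x < a)%N then c else d)).
rewrite (big_cat_nat _ aw) //=; congr (_ + _).
  rewrite -[X in _ * X%:R]subn0 mulr_natr -sumr_const_nat.
  by apply: eq_big_nat => x /andP[_ ->].
rewrite mulr_natr -sumr_const_nat.
by apply: eq_big_nat => x /andP[ax _]; rewrite ltnNge ax.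
Qed.

Section HiddenPartition.
Context {R : realType}.
Variables (N q w a : nat).

(* Block [j] is the set of indices [mxvec_index j r]; its first [w.+1] elements
   are rotated by [sigma j] and split into [a] elements of the hidden part and
   [w.+1 - a] decoys; the remaining [q - w.+1] elements are public. *)
Definition in_hidden (sigma : {ffun 'I_N -> 'I_w.+1}) (x : 'I_N * 'I_q) : bool :=
  ((inord x.2 + sigma x.1)%R < a)%N.

(** The position is tested first because [inord] sends positions from [w.+1] on to the default
    [ord0]. *)
Definition hidden_weight sigma (i : 'I_(N * q)) : R :=
  if ((cell i).2 < w.+1)%N then
    if in_hidden sigma (cell i) then (N * a)%:R^-1 else 0
  else 0.

Definition decoy_weight sigma (i : 'I_(N * q)) : R :=
  if ((cell i).2 < w.+1)%N then
    if in_hidden sigma (cell i) then 0 else (N * (w.+1 - a))%:R^-1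
  else 0.

Definition pooled_weight (i : 'I_(N * q)) : R :=
  if ((cell i).2 < w.+1)%N then (N * w.+1)%:R^-1 else 0.

Definition public_weight (l : R) (i : 'I_(N * q)) : R :=
  if ((cell i).2 < w.+1)%N then 0 else l / N%:R.

Hypotheses (N0 : (0 < N)%N) (a0 : (0 < a)%N) (aw : (a < w.+1)%N) (wq : (w < q)%N).

Let k : R := a%:R / w.+1%:R.

Lemma hidden_weight_ge0 sigma i : 0 <= hidden_weight sigma i.
Proof. by rewrite /hidden_weight; do 2?case: ifP. Qed.
Lemma decoy_weight_ge0 sigma i : 0 <= decoy_weight sigma i.
Proof. by rewrite /decoy_weight; do 2?case: ifP. Qed.
Lemma public_weight_ge0 l i : 0 <= l -> 0 <= public_weight l i.
Proof. by move=> l0; rewrite /public_weight; case: ifP => // _; rewrite divr_ge0. Qed.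

(** A rotation permutes the first [w.+1] positions, so every block has [a] hidden elements whatever
    [sigma] is. *)
Lemma sum_hidden (sigma : {ffun 'I_N -> 'I_w.+1}) (c d : R) :
  \sum_(i : 'I_(N * q)) (if ((cell i).2 < w.+1)%N then
     if in_hidden sigma (cell i) then c else d else 0)
  = N%:R * (c * a%:R + d * (w.+1 - a)%:R).
Proof.
rewrite sum_cells.
transitivity (\sum_(j < N) (c * a%:R + d * (w.+1 - a)%:R)); last first.
  by rewrite sumr_const card_ord mulr_natl.
apply: eq_bigr => j _; under eq_bigr => r _ do rewrite cell_mxvec_index /in_hidden /=.
rewrite (sum_low (fun x => if ((x + sigma j)%R < a)%N then c else d)) //.
by rewrite (sum_shift (fun x => if (x < a)%N then c else d)) sum_threshold // ltnW.
Qed.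

Lemma sum_hidden_weight sigma : \sum_i hidden_weight sigma i = 1.
Proof.
rewrite (sum_hidden sigma) mul0r addr0 mulrCA -natrM mulVf //.
by rewrite pnatr_eq0 -lt0n muln_gt0 N0.
Qed.

Lemma sum_decoy_weight sigma : \sum_i decoy_weight sigma i = 1.
Proof.
rewrite (sum_hidden sigma) mul0r add0r mulrCA -natrM mulVf //.
by rewrite pnatr_eq0 -lt0n muln_gt0 N0 subn_gt0.
Qed.

Lemma sum_public_weight l : \sum_i public_weight l i = l * (q - w.+1)%:R.
Proof.
rewrite sum_cells; under eq_bigr => j _ do under eq_bigr => r _ do
  rewrite /public_weight cell_mxvec_index /=.
under eq_bigr do rewrite sum_threshold // mul0r add0r.
rewrite sumr_const card_ord -mulr_natl; field.
by rewrite pnatr_eq0 -lt0n.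
Qed.

(** This is why values near the diagonal do not reveal [sigma]: [k / (N a)] and
    [(1 - k) / (N (w.+1 - a))] both equal [1 / (N w.+1)]. *)
Lemma pooled_weightE sigma S :
  k * outer_weight (hidden_weight sigma) S +
    (1 - k) * outer_weight (decoy_weight sigma) S = outer_weight pooled_weight S.
Proof.
rewrite /outer_weight !mulr_sumr -big_split /=; apply: eq_bigr => i _.
rewrite /hidden_weight /decoy_weight /pooled_weight; case: ifP => _; last by rewrite !mulr0 addr0.
have n0 : (N%:R : R) != 0 by rewrite pnatr_eq0 -lt0n.
have a0' : (a%:R : R) != 0 by rewrite pnatr_eq0 -lt0n.
have wa0 : ((w.+1 - a)%:R : R) != 0 by rewrite pnatr_eq0 -lt0n subn_gt0.
have w0 : (w.+1%:R : R) != 0 by rewrite pnatr_eq0.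
have wE : 1 - k = (w.+1 - a)%:R / w.+1%:R.
  by rewrite natrB ?(ltnW aw) // mulrBl divff.
rewrite wE /k !natrM; case: ifP => _; rewrite mulr0 ?addr0 ?add0r.
  by move: n0 a0' w0; clear; move: (N%:R) (a%:R) (w.+1%:R) => x y z *; field; apply/and3P.
by move: n0 wa0 w0; clear; move: (N%:R) ((w.+1 - a)%:R) (w.+1%:R) => x y z *; field; apply/and3P.
Qed.

(** Ties cardinality to the arguments of the loss: each omitted element counts once, in the pooled
    or in the public term. *)
Lemma outer_size (S : {set 'I_(N * q)}) :
  (N * q)%:R - #|S|%:R = (N * w.+1)%:R * outer_weight pooled_weight S +
    N%:R * outer_weight (public_weight 1) S :> R.
Proof.
have n0 : (N%:R : R) != 0 by rewrite pnatr_eq0 -lt0n.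
have -> : (N * q)%:R - #|S|%:R = \sum_(i | i \notin S) 1 :> R.
  apply/eqP; rewrite subr_eq; apply/eqP.
  transitivity ((#|S| + #|~: S|)%:R : R); first by rewrite cardsC card_ord.
  rewrite natrD addrC -[#|~: S|]sum1_card natr_sum; congr (_ + _).
  by apply: eq_bigl => i; rewrite inE.
rewrite /outer_weight !mulr_sumr -big_split /=; apply: eq_bigr => i _.
rewrite /pooled_weight /public_weight; case: ifP => _.
  by rewrite mulr0 addr0 divff // natrM mulf_neq0 // pnatr_eq0.
by rewrite mulr0 add0r mul1r divff.
Qed.

Lemma public_weight_scale l S :
  outer_weight (public_weight l) S = l * outer_weight (public_weight 1) S.
Proof.
rewrite /outer_weight mulr_sumr; apply: eq_bigr => i _; rewrite /public_weight.
by case: ifP => _; rewrite ?mulr0 // mul1r.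
Qed.

(** The planted optimum: everything but the decoys. *)
Definition public_hidden sigma : {set 'I_(N * q)} :=
  [set i | ~~ ((cell i).2 < w.+1)%N || in_hidden sigma (cell i)].

Lemma card_public_hidden sigma : (#|public_hidden sigma| = N * q - N * (w.+1 - a))%N.
Proof.
have D : (#|~: public_hidden sigma| = N * (w.+1 - a))%N.
  apply/eqP; rewrite -(eqr_nat R); apply/eqP.
  rewrite -sum1_card natr_sum.
  have := sum_hidden sigma 0 1; rewrite mul0r add0r mul1r -natrM => <-.
  rewrite big_mkcond; apply: eq_bigr => i _; rewrite !inE negb_or negbK.
  by case: (_ < _)%N; case: in_hidden.
by rewrite -D -[in LHS](finset.setCK (public_hidden sigma)) cardsCs finset.setCK card_ord.
Qed.

Lemma outer_public_hidden sigma l :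
  [/\ outer_weight (hidden_weight sigma) (public_hidden sigma) = 0,
      outer_weight (decoy_weight sigma) (public_hidden sigma) = 1 &
      outer_weight (public_weight l) (public_hidden sigma) = 0].
Proof.
split.
- apply: big1 => i; rewrite !inE negb_or negbK => /andP[h1 h2].
  by rewrite /hidden_weight h1 (negbTE h2).
- rewrite -[RHS](sum_decoy_weight sigma) [RHS](bigID (mem (public_hidden sigma))) /=.
  rewrite [X in _ = X + _]big1 ?add0r // => i; rewrite inE /decoy_weight.
  by case: (_ < _)%N => //= ->.
- apply: big1 => i; rewrite !inE negb_or negbK => /andP[h1 h2].
  by rewrite /public_weight h1.
Qed.

(** The share of block [j], rotated by [s], in [N] times the gap between the left-out hidden and
    decoy fractions; the Chernoff bound is applied to it. *)
Definition imbalance (S : {set 'I_(N * q)}) (j : 'I_N) (s : 'I_w.+1) : R :=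
  \sum_(r < q) (if (r < w.+1)%N then
    if mxvec_index j r \notin S then
      if ((inord r + s)%R < a)%N then a%:R^-1 else - (w.+1 - a)%:R^-1
    else 0
  else 0).

Lemma imbalanceE S (sigma : {ffun 'I_N -> 'I_w.+1}) :
  \sum_j imbalance S j (sigma j) =
    N%:R * (outer_weight (hidden_weight sigma) S - outer_weight (decoy_weight sigma) S).
Proof.
have n0 : (N%:R : R) != 0 by rewrite pnatr_eq0 -lt0n.
rewrite /outer_weight -sumrB [X in _ = _ * X]big_mkcond sum_cells mulr_sumr; apply: eq_bigr => j _.
rewrite mulr_sumr; apply: eq_bigr => r _.
rewrite /hidden_weight /decoy_weight cell_mxvec_index /in_hidden /=.
case: ifP => _; last by case: ifP; rewrite ?subr0 ?mulr0.
case: ifP => _; last by rewrite mulr0.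
by case: ifP => _; rewrite ?subr0 ?sub0r ?mulrN natrM invfM mulVKf.
Qed.

(** Each position is hidden for [a] rotations and a decoy for the other [w.+1 - a], so its weights
    cancel. *)
Lemma imbalance_sum0 S j : \sum_s imbalance S j s = 0.
Proof.
rewrite /imbalance exchange_big /= big1 // => r _.
case: (r < w.+1)%N; last by rewrite big1.
case: (_ \notin S); last by rewrite big1.
pose G (x : 'I_w.+1) : R := if (x < a)%N then a%:R^-1 else - (w.+1 - a)%:R^-1.
transitivity (\sum_s G (s + inord r)).
  by apply: eq_bigr => s _; rewrite /G (addrC s).
rewrite sum_shift /G.
rewrite sum_threshold ?(ltnW aw) // mulNr !mulVf ?subrr //.
  by rewrite pnatr_eq0 -lt0n subn_gt0.
by rewrite pnatr_eq0 -lt0n.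
Qed.

Lemma imbalance_le S j s : `|imbalance S j s| <= q%:R.
Proof.
rewrite -[X in X%:R](card_ord q) -sumr_const /imbalance.
apply: le_trans (ler_norm_sum _ _ _) _; apply: ler_sum => r _.
have inv1 (m : nat) : (0 < m)%N -> (m%:R : R)^-1 <= 1.
  by move=> m0; rewrite invf_le1 ?ltr0n // ler1n.
case: ifP => _; last by rewrite normr0.
case: ifP => _; last by rewrite normr0.
by case: ifP => _; rewrite ?normrN ger0_norm ?invr_ge0 // inv1 // subn_gt0.
Qed.

End HiddenPartition.

(** * Inapproximability *)

Lemma exists_expr_lt (R : realType) (lam e : R) : 0 <= lam -> lam < 1 -> 0 < e ->
  exists k, forall n, (k <= n)%N -> lam ^+ n < e.
Proof.
move=> l0 l1 e0; have nl : `|lam| < 1 by rewrite ger0_norm.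
have /cvgrPdist_lt /(_ e e0) [k _ H] := cvg_expr nl.
exists k => n kn; have := H n kn.
by rewrite /= sub0r normrN ger0_norm // exprn_ge0.
Qed.

(** Fix [k] with [2^Q lam^k <= 1/2]; subexponentiality bounds the [k]-th power of the product by
    [4^k 2^(-N)], which is eventually below [eta^k]. *)
Lemma subexponential_mul_geometric (R : realType) (q : nat -> nat) (Q : nat)
    (lam eta : R) : subexponential q -> 0 <= lam -> lam < 1 -> 0 < eta -> (0 < Q)%N ->
  exists2 N, (0 < N)%N & (q (N * Q)%N).+1%:R * (2 * lam ^+ N) < eta.
Proof.
move=> hq l0 l1 eta0 Q0.
have [k0 hk0] := @exists_expr_lt R lam (2^-1 / 2 ^+ Q) l0 l1
  ltac:(by rewrite divr_gt0 // exprn_gt0).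
pose k := k0.+1.
have hk : 2 ^+ Q * lam ^+ k <= 2^-1.
  have := hk0 k (leqnSn _); rewrite ltr_pdivlMr ?exprn_gt0 // mulrC; exact: ltW.
have [n0 hn0] := hq k isT.
have [m0 hm0] := @exists_expr_lt R 2^-1 ((eta / 4) ^+ k) ltac:(by [])
  ltac:(by rewrite invf_lt1 // ltr1n)
  ltac:(by rewrite exprn_gt0 // divr_gt0).
pose N := (n0 + m0).+1.
exists N => //.
have n0N : (n0 <= N * Q)%N.
  by apply: leq_trans (leq_pmulr _ Q0); exact: leqW (leq_addr _ _).
have hN : 2^-1 ^+ N < (eta / 4) ^+ k :> R by apply: hm0; apply: leqW (leq_addl _ _).
set m := q (N * Q)%N.
have mk : (m.+1 ^ k <= 2 ^ k * 2 ^ (N * Q))%N.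
  (* [maxn m 1] covers [m = 0], where [m.+1 <= 2 * m] fails. *)
  apply: (@leq_trans ((2 * maxn m 1) ^ k)).
    by rewrite leq_exp2r // mul2n -addnn -addn1 leq_add ?leq_maxl ?leq_maxr.
  rewrite expnMn leq_mul2l; apply/orP; right.
  by rewrite /maxn; case: ifP => _; [rewrite exp1n expn_gt0|apply: hn0].
have x0 : 0 <= m.+1%:R * (2 * lam ^+ N) :> R by rewrite !mulr_ge0 ?exprn_ge0.
rewrite -(@ltr_pXn2r _ k) ?nnegrE ?(ltW eta0) //.
apply: (@le_lt_trans _ _ (4 ^+ k * 2^-1 ^+ N)); last first.
  have -> : eta ^+ k = 4 ^+ k * (eta / 4) ^+ k by rewrite -exprMn; congr (_ ^+ _); field.
  by rewrite ltr_pM2l // exprn_gt0.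
apply: (@le_trans _ _ ((2 ^ k * 2 ^ (N * Q))%:R * (2 ^+ k * (lam ^+ k) ^+ N))).
  rewrite exprMn [(2 * _) ^+ k]exprMn (exprAC lam).
  by rewrite ler_wpM2r ?mulr_ge0 ?exprn_ge0 // -natrX ler_nat.
rewrite natrM !natrX.
have -> : 2 ^+ k * 2 ^+ (N * Q) * (2 ^+ k * (lam ^+ k) ^+ N) =
   4 ^+ k * (2 ^+ Q * lam ^+ k) ^+ N :> R.
  rewrite (exprMn _ (2 ^+ Q)) (mulnC N) (exprM 2 Q) (_ : 4 = 2 * 2 :> R); last by ring.
  rewrite (exprMn _ 2 2); ring.
rewrite ler_wpM2l ?exprn_ge0 // lerXn2r ?nnegrE ?mulr_ge0 ?exprn_ge0 //.
Qed.

(** Each block has [Q] elements and budget [p]: [a] hidden, [Q - p] decoys, the rest public. In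
    [bound], [y] is the pooled fraction left out and [e] the number of public elements left out per
    block; it makes every output of allowed size lose [eps] on the symmetric function. The average
    over rotations then stays below [1 - eps + delta / 2], although each optimum is at least
    [1 - delta / 4]. *)
Lemma no_bicriteria (R : realType) (c : rat) (eps delta beta mu l : R)
    (p Q a w : nat)
    (d : measure_display) (Omega : measurableType d) (P : probability Omega R)
    (A : rand_alg R Omega) (q : nat -> nat) :
  0 < eps -> eps < 1 -> 0 < delta -> delta <= eps ->
  (ratr c * Q%:R = p%:R :> R) -> (p < Q)%N ->
  (0 < a)%N -> (a.*2 <= w.+1)%N -> (w < Q)%N -> (w.+1 - a = Q - p)%N ->
  0 <= mu -> 0 <= l -> l * (Q - w.+1)%:R <= 1 - mu ->
  (forall y e : R, 0 <= y -> 0 <= e -> (Q = w.+1 -> e = 0) ->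
     Q%:R - beta * p%:R <= w.+1%:R * y + e ->
     eps <= mu * (y * y `^ ((w.+1 - a)%:R / a%:R)) + l * e) ->
  alg_measurable A -> subexponential q -> query_bounded A c q ->
  ~ bicriteria P A c (1 - eps + delta) beta.
Proof.
move=> eps0 eps1 delta0 delta1 cQ pQ a0 aw2 wQ waQ mu0 l0 lmu bound mA hq hAq bic.
have aw : (a < w.+1)%N by apply: leq_trans aw2; rewrite -addnn -addn1 leq_add2l.
set b := _ / _ in bound; pose k : R := a%:R / w.+1%:R.
have aR : 0 < a%:R :> R by rewrite ltr0n.
have wR : 0 < w.+1%:R :> R by rewrite ltr0n.
have k0 : 0 < k by rewrite divr_gt0.
have k1 : k < 1 by rewrite ltr_pdivrMr // mul1r ltr_nat.
have bk : b * k = 1 - k.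
  by rewrite /b /k natrB ?(ltnW aw) //; field; rewrite !gt_eqF.
have b1 : 1 <= b.
  by rewrite ler_pdivlMr // mul1r ler_nat leq_subRL ?(ltnW aw) // addnn.
have mu1 : mu <= 1 by have := mulr_ge0 l0 (ler0n R (Q - w.+1)); lra.
(* The optimum loses a quarter of [delta] and the detectable rotations account for less than half of
   it, which leaves a contradiction. *)
pose theta := delta / 4.
have th0 : 0 < theta by rewrite divr_gt0.
have th1 : theta <= 1 by rewrite /theta; lra.
have QR : 0 < Q%:R :> R by rewrite ltr0n (leq_trans _ pQ).
have [lam [lam0 lam1 chern]] := chernoff_rate QR th0.
have Q0 : (0 < Q)%N by apply: leq_trans pQ.
have [N N0 small] := subexponential_mul_geometric hq lam0 lam1
  (divr_gt0 delta0 (ltr0n R 2 : 0 < 2)) Q0.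
have NR : 0 < N%:R :> R by rewrite ltr0n.
pose n := (N * Q)%N; pose B := (N * p)%N.
have dens : has_density R c n B by rewrite /has_density /n /B !natrM mulrCA cQ.
pose Sig := {ffun 'I_N -> 'I_w.+1}.
pose f (sigma : Sig) : {set 'I_n} -> R :=
  hidden_fun k b theta mu (hidden_weight a sigma) (decoy_weight a sigma) (public_weight w l).
pose g (S : {set 'I_n}) : R :=
  1 - mu * (outer_weight (pooled_weight w) S * outer_weight (pooled_weight w) S `^ b)
    - outer_weight (public_weight w l) S.
have V1 (sigma : Sig) (i : 'I_n) : 0 <= hidden_weight a sigma i :> R by exact: hidden_weight_ge0.
have V2 (sigma : Sig) (i : 'I_n) : 0 <= decoy_weight a sigma i :> R by exact: decoy_weight_ge0.
have V3 (i : 'I_n) : 0 <= public_weight w l i by exact: public_weight_ge0.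
have W3s : \sum_(i : 'I_n) public_weight w l i <= 1 - mu by rewrite sum_public_weight.
have tot (W : 'I_n -> R) : outer_weight W finset.set0 = \sum_i W i.
  by apply: eq_bigl => i; rewrite inE.
have fvalid sigma : valid_instance (f sigma).
  by apply: hidden_fun_valid => //; rewrite ?sum_hidden_weight ?sum_decoy_weight //; apply: ltW.
have near (th : R) (sigma : Sig) (S : {set 'I_n}) :
    `|outer_weight (hidden_weight a sigma) S - outer_weight (decoy_weight a sigma) S| <= th ->
    hidden_fun k b th mu (hidden_weight a sigma) (decoy_weight a sigma)
      (public_weight w l) S = g S.
  by move=> h; rewrite /hidden_fun /g loss_near_diagonal // pooled_weightE.
(* With threshold 1 every set is balanced, so [g] is itself a hidden function. *)
have gvalid : valid_instance g.
  pose sigma : Sig := [ffun=> ord0].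
  have -> : g = hidden_fun k b 1 mu (hidden_weight a sigma) (decoy_weight a sigma)
      (public_weight w l).
    apply/funext => S; rewrite near //.
    have o1 := outer_weight_ge0 S (V1 sigma); have o2 := outer_weight_ge0 S (V2 sigma).
    have := outer_weight_anti (V1 sigma) (finset.sub0set S).
    have := outer_weight_anti (V2 sigma) (finset.sub0set S).
    by rewrite !tot sum_hidden_weight // sum_decoy_weight //
      ler_norml => *; apply/andP; split; lra.
  by apply: hidden_fun_valid => //; rewrite ?sum_hidden_weight ?sum_decoy_weight.
have f1 sigma S : f sigma S <= 1 by apply: hidden_fun_le1 => //; apply: ltW.
have f0 sigma S : 0 <= f sigma S by case: (fvalid sigma).
have g0 S : 0 <= g S by case: gvalid.
have opt sigma : 1 - theta <= optval B (f sigma).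
  pose T : {set 'I_n} := public_hidden Q a sigma.
  have TB : (#|T| <= B)%N.
    by rewrite card_public_hidden // waQ -mulnBr subKn // ltnW.
  apply: (@le_trans _ _ (f sigma T)); last exact: le_bigmax_cond.
  rewrite /f /hidden_fun.
  have [-> -> ->] := outer_public_hidden N0 aw wQ sigma l.
  have : mu * loss k b theta 0 1 <= theta.
    apply: (@le_trans _ _ (1 * loss k b theta 0 1)).
      by rewrite ler_wpM2r // loss_ge0 // ltW.
    by rewrite mul1r; apply: loss01 => //; apply: ltW.
  by lra.
have gbound (S : {set 'I_n}) : #|S|%:R <= beta * B%:R -> g S <= 1 - eps.
  move=> SB; have Y0 : 0 <= outer_weight (pooled_weight w) S :> R.
    by apply: outer_weight_ge0 => i; rewrite /pooled_weight; case: ifP.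
  have V31 (i : 'I_n) : 0 <= public_weight w 1 i :> R by exact: public_weight_ge0.
  have E0 : 0 <= outer_weight (public_weight w 1) S :> R by exact: outer_weight_ge0.
  have E1 : Q = w.+1 -> outer_weight (public_weight w 1) S = 0 :> R.
    move=> Qw; apply/eqP; rewrite eq_le E0 andbT.
    have := outer_weight_anti V31 (finset.sub0set S).
    by rewrite tot sum_public_weight // (_ : (Q - w.+1)%N = 0%N) ?mulr0 //;
      apply/eqP; rewrite subn_eq0 Qw.
  have := bound _ _ Y0 E0 E1.
  rewrite -(ler_pM2l NR).
  have -> : N%:R * (w.+1%:R * outer_weight (pooled_weight w) S +
      outer_weight (public_weight w 1) S) =
      n%:R - #|S|%:R :> R.
    apply/esym; rewrite mulrDr mulrA -natrM; exact: outer_size.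
  have -> : N%:R * (Q%:R - beta * p%:R) = n%:R - beta * B%:R :> R.
    by rewrite /n /B !natrM; ring.
  have h : n%:R - beta * B%:R <= n%:R - #|S|%:R by lra.
  by move=> /(_ h); rewrite -public_weight_scale /g; lra.
pose m := q n; pose eta : R := 2 * lam ^+ N.
have eta0 : 0 <= eta by rewrite mulr_ge0 // exprn_ge0.
have diff S : #|[set sigma | f sigma S != g S]|%:R <= eta * #|{: Sig}|%:R.
  have := chern _ _ (imbalance a S) (imbalance_le a0 aw S) (imbalance_sum0 a0 aw S).
  rewrite !card_ord card_ffun !card_ord; apply: le_trans; rewrite ler_nat.
  apply/subset_leq_card/fintype.subsetP => sigma; rewrite !inE.
  apply: contraNT; rewrite -ltNge imbalanceE // normrM normr_nat mulrC ltr_pM2r //.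
  by move=> /ltW h; apply/eqP; apply: near.
(* Oversized outputs on [g] have probability zero, so [gbound] applies for almost every seed. *)
have [galpha gnull] := bic n B g dens gvalid.
have sumle := @sum_expectation_le R d Omega P Sig {set 'I_n}
  (fun sigma om => run_out (A n B om) (f sigma)) f (fun om => run_out (A n B om) g)
  (fun S => beta * B%:R < #|S|%:R)
  (#|{: Sig}|%:R * (1 - eps) + m.+1%:R * (eta * #|{: Sig}|%:R))
  (fun sigma => mA n B (f sigma)) (mA n B g) gnull f0.
have Sig0 : 0 < #|{: Sig}|%:R :> R.
  by rewrite ltr0n card_ffun !card_ord expn_gt0.
have {}sumle : \sum_sigma exp_value P A B (f sigma) <=
    #|{: Sig}|%:R * (1 - eps) + m.+1%:R * (eta * #|{: Sig}|%:R).
  apply: sumle.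
    by rewrite addr_ge0 ?mulr_ge0 ?exprn_ge0 // subr_ge0 ltW.
  move=> om; rewrite -leNgt => small_out.
  have := @sum_run_out_le R n Sig (A n B om) f g (eta * #|{: Sig}|%:R) m f1 (g0 _)
    ltac:(by rewrite mulr_ge0) diff (hAq n B g om dens gvalid).
  move/le_trans; apply; rewrite lerD2r ler_wpM2l //; exact: gbound.
have lower : #|{: Sig}|%:R * ((1 - eps + delta) * (1 - theta)) <=
    \sum_sigma exp_value P A B (f sigma).
  rewrite mulr_natl -sumr_const; apply: ler_sum => sigma _.
  have [h _] := bic n B (f sigma) dens (fvalid sigma).
  by apply: le_trans h; rewrite ler_wpM2l //; lra.
have := le_trans lower sumle.
have -> : #|{: Sig}|%:R * (1 - eps) + m.+1%:R * (eta * #|{: Sig}|%:R) =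
    #|{: Sig}|%:R * (1 - eps + m.+1%:R * eta) :> R by ring.
rewrite ler_pM2l //.
have : (1 - eps + delta) * theta <= 1 * theta by rewrite ler_wpM2r //; lra.
by move: small; rewrite -/n -/m -/eta mulrBr mulr1 /theta; lra.
Qed.

Lemma rat_fraction (R : realType) (c : rat) : 0 < c -> c < 1 ->
  exists p Q : nat, [/\ (0 < p)%N, (p < Q)%N & ratr c * Q%:R = p%:R :> R].
Proof.
move=> c0 c1; exists `|numq c|%N, `|denq c|%N.
have cE : ratr c * `|denq c|%:R = `|numq c|%:R :> R.
  rewrite /ratr !natr_absz ger0_norm ?denq_ge0 // ger0_norm ?numq_ge0 1?ltW //.
  by rewrite divfK // intr_eq0 denq_eq0.
split => //; first by rewrite absz_gt0 numq_eq0 gt_eqF.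
rewrite -(ltr_nat R) -cE -[ltRHS]mul1r ltr_pM2r ?ltr0n ?absz_gt0 ?denq_eq0 //.
by rewrite -(rmorph1 (@ratr R)) ltr_rat.
Qed.

(** The right side is the [1/c]-th power of [y]; size [rho] times the budget leaves out exactly the
    fraction [eps^c] when [c <= 1/2]. *)
Lemma powR_tradeoff (R : realType) (c y eps : R) : 0 < c -> 0 < eps ->
  eps `^ c <= y -> eps <= y * y `^ ((1 - c) / c).
Proof.
move=> c0 eps0 h.
have y0 : 0 < y by apply: lt_le_trans h; rewrite powR_gt0.
have -> : y * y `^ ((1 - c) / c) = y `^ c^-1.
  rewrite -{1}(powRr1 (ltW y0)) -powRD; last by rewrite (gt_eqF y0) implybT.
  by congr (_ `^ _); field; rewrite gt_eqF.
have {1}-> : eps = (eps `^ c) `^ c^-1.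
  by rewrite -powRrM divff ?gt_eqF // powRr1 // ltW.
apply: ge0_ler_powR => //; rewrite ?nnegrE ?powR_ge0 ?invr_ge0 ?(ltW c0) ?(ltW y0) //.
Qed.

(* [2 s y - s ^ 2] is the tangent of [y ^ 2] at [s = sqrt eps]; [mu] makes its
   slope per element equal to the slope [l] of the linear part. *)
Lemma sqrt_tradeoff (R : realType) (c y e eps : R) :
  2^-1 < c -> c < 1 -> 0 < eps -> 0 <= y ->
  let mu := (1 - c) / ((1 - c) + (2 * c - 1) * Num.sqrt eps) in
  2 * (1 - c) * Num.sqrt eps + eps * (2 * c - 1) <= 2 * (1 - c) * y + e ->
  eps <= mu * (y * y) + mu * Num.sqrt eps / (1 - c) * e.
Proof.
move=> c0 c1 eps0 y0 mu h.
set s := Num.sqrt eps in mu h *.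
have s0 : 0 < s by rewrite sqrtr_gt0.
have es : eps = s * s by rewrite -expr2 sqr_sqrtr // ltW.
have D0 : 0 < (1 - c) + (2 * c - 1) * s.
  have : 0 < (2 * c - 1) * s by rewrite mulr_gt0 //; lra.
  by move: c1; clear; lra.
have mu0 : 0 <= mu by rewrite divr_ge0 ?ltW // subr_gt0.
have l0 : 0 <= mu * s / (1 - c) by apply: divr_ge0; [apply: mulr_ge0 => //; apply: ltW|
  rewrite subr_ge0 ltW].
have h2 := ler_wpM2l l0 h.
have h3 : mu * (2 * s * y - s * s) <= mu * (y * y).
  rewrite ler_wpM2l // -subr_ge0.
  have -> : y * y - (2 * s * y - s * s) = (y - s) ^+ 2 by ring.
  exact: sqr_ge0.
have c1' : 1 - c != 0 by rewrite gt_eqF // subr_gt0.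
have E : eps = mu * s / (1 - c) * (2 * (1 - c) * s + eps * (2 * c - 1)) - mu * (s * s).
  by rewrite es /mu; field; rewrite c1' gt_eqF.
have E2 : mu * s / (1 - c) * (2 * (1 - c) * y + e) = mu * (2 * s * y) + mu * s / (1 - c) * e.
  by field.
move: h2 h3; rewrite E2 mulrBr; move: E; clear; lra.
Qed.
Unset Implicit Arguments.

Theorem theorem4p7 (R : realType) (c : rat) (eps delta : R)
  (hc0 : 0 < c) (hc1 : c < 1)
  (heps0 : 0 < eps) (heps1 : eps < 1)
  (hdelta0 : 0 < delta) (hdelta1 : delta <= eps)
  (d : measure_display) (Omega : measurableType d) (P : probability Omega R)
  (A : rand_alg R Omega) (q : nat -> nat)
  (hA : alg_measurable A) (hq : subexponential q)
  (hAq : query_bounded A c q) :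
  ~ bicriteria P A c (1 - eps + delta) (rho c eps).
Proof.
have [p [Q [p0 pQ cQ]]] := rat_fraction R hc0 hc1.
set cr := ratr c : R in cQ.
have c0 : 0 < cr by rewrite ltr0q.
have c1 : cr < 1 by rewrite -(rmorph1 (@ratr R)) ltr_rat.
have Q0 : (0 < Q)%N by apply: leq_trans pQ.
have QR : 0 < Q%:R :> R by rewrite ltr0n.
have half : (cr <= 2^-1) = (p.*2 <= Q)%N.
  rewrite -(ler_nat R) -mul2n natrM -cQ mulrA -[X in _ = (_ <= X)]mul1r ler_pM2r //.
  by apply/idP/idP; lra.
have crE : cr = p%:R / Q%:R by rewrite -cQ mulfK // gt_eqF.
rewrite /rho -/cr half; case: ifPn => [p2Q|]; last rewrite -ltnNge => Qp2.
  (* Low density: the whole block is rotated and [a = p], so [k = c] and no element is public. *)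
  case: Q => // w in pQ cQ Q0 QR half crE p2Q *.
  apply: (@no_bicriteria R c eps delta _ 1 0 p w.+1 p w d Omega P A q) => //.
    by rewrite mul0r subrr.
  move=> y e y0 e0 /(_ erefl) ->; rewrite mul1r mul0r !addr0 => h.
  have -> : (w.+1 - p)%:R / p%:R = (1 - cr) / cr.
    rewrite crE natrB ?(ltnW pQ) //; field.
    by rewrite !gt_eqF // ltr0n.
  apply: powR_tradeoff => //; rewrite -(ler_pM2l QR).
  apply: le_trans h; rewrite -cQ le_eqVlt; apply/orP; left; apply/eqP.
  by field; rewrite gt_eqF.
(* High density: [a = Q - p] among [2 (Q - p)] rotated elements, so [k = 1/2] and the exponent [b]
   is 1. *)
have wE : (Q - p).*2.-1.+1 = (Q - p).*2 by rewrite prednK // double_gt0 subn_gt0.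
have QpR : (Q - p)%:R = (1 - cr) * Q%:R :> R.
  by rewrite natrB ?(ltnW pQ) // mulrBl mul1r cQ.
have c2 : 2^-1 < cr by rewrite ltNge half -ltnNge.
have wQ : ((Q - p).*2 <= Q)%N.
  by rewrite -(leq_add2r p.*2) -doubleD subnK ?(ltnW pQ) // -addnn leq_add2l ltnW.
have wR : ((Q - p).*2)%:R = 2 * (1 - cr) * Q%:R :> R.
  by rewrite -mul2n natrM QpR mulrA.
have QwR : (Q - (Q - p).*2)%:R = (2 * cr - 1) * Q%:R :> R.
  by rewrite natrB // wR; ring.
have s0 : 0 < Num.sqrt eps by rewrite sqrtr_gt0.
set D := (1 - cr) + (2 * cr - 1) * Num.sqrt eps.
have D0 : 0 < D.
  have : 0 < (2 * cr - 1) * Num.sqrt eps by rewrite mulr_gt0 //; lra.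
  by rewrite /D; move: c1; clear; lra.
pose mu := (1 - cr) / D.
have mu0 : 0 <= mu by rewrite divr_ge0 ?(ltW D0) // subr_ge0 ltW.
have c1' : 0 < 1 - cr by rewrite subr_gt0.
(* The slope is divided by [Q] because [e] counts elements of a block, whereas [sqrt_tradeoff] takes
   their fraction. *)
apply: (@no_bicriteria R c eps delta _ mu (mu * Num.sqrt eps / (1 - cr) / Q%:R)
  p Q (Q - p) (Q - p).*2.-1 d Omega P A q) => //; rewrite ?wE //.
- by rewrite subn_gt0.
- by rewrite -addnn addnK.
- apply: divr_ge0 => //; apply: divr_ge0; last exact: ltW.
  by apply: mulr_ge0 => //; apply: ltW.
- rewrite QwR le_eqVlt; apply/orP; left; apply/eqP.
  by rewrite /mu /D; field; rewrite -/D !gt_eqF.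
move=> y e y0 e0 _ h.
rewrite -addnn addnK divff ?pnatr_eq0 -?lt0n ?subn_gt0 // powRr1 //.
have -> : mu * Num.sqrt eps / (1 - cr) / Q%:R * e =
  mu * Num.sqrt eps / (1 - cr) * (e / Q%:R) by rewrite mulrAC -!mulrA.
apply: sqrt_tradeoff => //.
rewrite -(ler_pM2l QR).
have -> : Q%:R * (2 * (1 - cr) * y + e / Q%:R) = ((Q - p).*2)%:R * y + e.
  by rewrite wR; field; rewrite gt_eqF.
apply: le_trans h; rewrite -cQ le_eqVlt; apply/orP; left; apply/eqP.
by field; rewrite gt_eqF.
Qed.
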